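(* For every $k\geq 3$ there exists $\epsilon_k\in\left(0,\frac{1}{k-1}\right)$ such that for every $0<c<1/\binom{k}{2}$, with probability $1-o(1)$ as $n\to\infty$, a random instance of 1-in-$k$ SAT on $n$ variables with clause/variable ratio $c$ has no hole of size at least $\epsilon_k n$.
   Context: An instance of 1-in-$k$ SAT on variables $x_1,\dots,x_n$ is a conjunction of clauses, each consisting of exactly $k$ literals on $k$ distinct variables; an assignment satisfies it if in every clause exactly one literal is true. The random instance with clause/variable ratio $c$ is taken in the constant probability model: each of the $2^k\binom nk$ possible clauses is included independently with probability $p$, where $p\cdot2^k\binom nk=cn$. Let $d_H$ denote Hamming distance. A pair $(A,B)$ of assignments is a hole of $\Phi$ if $A$ and $B$ are satisfying assignments of $\Phi$ and there is no satisfying assignment $C$ of $\Phi$ with $d_H(A,C)+d_H(C,B)=d_H(A,B)$; its size is $d_H(A,B)$. *)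

(* Defs.v *)
From Stdlib Require Import Reals.
From mathcomp Require Import all_boot.

Set Implicit Arguments.
Unset Strict Implicit.
Unset Printing Implicit Defensive.

(* A literal on x_0..x_{n-1}: (variable, polarity); (i, b) is true under A iff A i = b. *)
Notation literal n := ('I_n * bool)%type.
Notation clause n := {set literal n}.
Notation formula n := {set clause n}.
Notation assignment n := {ffun 'I_n -> bool}.

Definition valid_clause n k (C : clause n) : bool :=
  (#|C| == k) && (#|[set l.1 | l in C]| == k).

(* The set of all 2^k * 'C(n,k) possible clauses. *)
Definition all_clauses n k : formula n := [set C | valid_clause k C].

Definition is_instance n k (Phi : formula n) : bool := Phi \subset all_clauses n k.

Definition clause_sat n (A : assignment n) (C : clause n) : bool :=
  #|[set l in C | A l.1 == l.2]| == 1.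

Definition satisfies n (Phi : formula n) (A : assignment n) : bool :=
  [forall C in Phi, clause_sat A C].

Definition dH n (A B : assignment n) : nat := #|[set i | A i != B i]|.

Definition is_hole n (Phi : formula n) (A B : assignment n) : bool :=
  [&& satisfies Phi A, satisfies Phi B &
      ~~ [exists C : assignment n,
            [&& satisfies Phi C, C != A, C != B &
                dH A C + dH C B == dH A B]]].

Local Open Scope R_scope.

Definition Rleb (x y : R) : bool := if Rle_dec x y then true else false.

Definition has_big_hole n (eps : R) (Phi : formula n) : bool :=
  [exists A : assignment n, exists B : assignment n,
     is_hole Phi A B && Rleb (eps * INR n) (INR (dH A B))].

(* Constant probability model: p * 2^k * C(n,k) = c n. *)
Definition clause_prob (n k : nat) (c : R) : R :=
  c * INR n / INR (2 ^ k * 'C(n, k))%N.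

(* Probability of the event E for the random instance: each of the possible
   clauses included independently with probability p. *)
Definition Prob (n k : nat) (c : R) (E : pred (formula n)) : R :=
  let p := clause_prob n k c in
  let M := #|all_clauses n k| in
  foldr (fun Phi acc =>
           ((if E Phi then pow p #|Phi| * pow (1 - p) (M - #|Phi|)%N else 0) + acc))
        0 (enum [set Phi : formula n | is_instance k Phi]).
Arguments Prob n k c E : clear implicits.
Arguments has_big_hole n eps Phi : clear implicits.

(* Main.v *)
Require Import Defs.
From Stdlib Require Import Reals.
From mathcomp Require Import all_boot.
From HB Require Import structures.
From Stdlib Require Import Lra.
Local Open Scope R_scope.

(** Let [A] and [B] form a hole and let [D] be the set of variables on which
    they differ. A clause satisfied by both has at most two variables in [D],
    since a literal over [D] is true under exactly one of [A] and [B]. If no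
    clause linked a nonempty proper subset [T] of [D] to [D :\: T], flipping [A]
    on [T] would give a satisfying assignment strictly between [A] and [B]; so
    the clauses connect [D], and there are at least [#|D| - 1] of them. The
    number of clauses is binomial with mean [c n] and [c < 1 / 'C(k, 2)], so by
    Chernoff's bound it is below [n / 'C(k, 2) - 1] with high probability.
    Hence [eps = 1 / 'C(k, 2)], which is less than [1 / (k - 1)], works. *)

(** * Clauses meeting the difference set of a hole *)

Definition vars {n} (C : clause n) : {set 'I_n} := [set l.1 | l in C].

Lemma mem_vars n (C : clause n) (l : literal n) : l \in C -> l.1 \in vars C.
Proof. exact: imset_f. Qed.

Lemma eq_clause_sat n (A B : assignment n) (C : clause n) :
  {in vars C, A =1 B} -> clause_sat A C = clause_sat B C.
Proof.
move=> eqAB; rewrite /clause_sat; congr (_ == 1)%N.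
by apply: eq_card => l; rewrite !inE; case: (boolP (l \in C)) => //= /mem_vars/eqAB->.
Qed.

Definition diff {n} (A B : assignment n) : {set 'I_n} := [set i | A i != B i].

Lemma card_vars_diff n (A B : assignment n) (C : clause n) :
  clause_sat A C -> clause_sat B C -> (#|vars C :&: diff A B| <= 2)%N.
Proof.
move=> /eqP cA /eqP cB.
set TA := [set l in C | A l.1 == l.2] in cA.
set TB := [set l in C | B l.1 == l.2] in cB.
have sub : vars C :&: diff A B \subset [set l.1 | l in TA :|: TB].
  apply/subsetP => i /setIP[/imsetP[l lC ->]]; rewrite inE => neqAB.
  apply: imset_f; rewrite !inE lC /=.
  by move: neqAB; case: (A l.1); case: (B l.1); case: l.2.
apply: leq_trans (subset_leq_card sub) _; apply: leq_trans (leq_imset_card _ _) _.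
by apply: leq_trans (leq_card_setU _ _) _; rewrite cA cB.
Qed.

Lemma hole_crossing n (Phi : formula n) (A B : assignment n) (T : {set 'I_n}) :
  is_hole Phi A B -> T != set0 -> T \proper diff A B ->
  exists2 C, C \in Phi &
    ~~ (vars C :&: diff A B \subset T) && (vars C :&: T != set0).
Proof.
case/and3P=> /'forall_implyP satA /'forall_implyP satB no_between T0 /properP[sTD [j jD jT]].
have [/existsP[C /and3P[CPhi C1 C2]]|/existsPn none] :=
  boolP [exists C, [&& C \in Phi, ~~ (vars C :&: diff A B \subset T) & vars C :&: T != set0]].
  by exists C => //; rewrite C1.
case/negP: no_between; apply/existsP.
pose F : assignment n := [ffun i => if i \in T then B i else A i].
have memD i : (i \in diff A B) = (A i != B i) by rewrite inE.
exists F; apply/and4P; split.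
(* A clause not crossing [T] either has all its variables from [diff A B] in [T], and then [F]
   agrees with [B] on it, or misses [T], and then [F] agrees with [A] on it. *)
- apply/'forall_implyP => C CPhi; have := none C; rewrite CPhi /=.
  rewrite negb_and !negbK => /orP[/subsetP sT|/eqP dT].
    rewrite (@eq_clause_sat _ F B) ?satB // => i iC; rewrite ffunE.
    case: ifPn => // iT; apply/eqP; apply: contraNT iT => iD.
    by apply: sT; rewrite in_setI iC memD.
  rewrite (@eq_clause_sat _ F A) ?satA // => i iC; rewrite ffunE.
  by case: ifP => // iT; move/setP/(_ i): dT; rewrite in_setI iC iT inE.
- have [i iT] := set0Pn _ T0; apply/eqP => /ffunP/(_ i); rewrite ffunE iT.
  by apply/eqP; rewrite eq_sym -memD (subsetP sTD).
- apply/eqP => /ffunP/(_ j); rewrite ffunE (negPf jT).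
  by apply/eqP; rewrite -memD.
have -> : dH A F = #|T|.
  apply: eq_card => i; rewrite inE ffunE; case: ifP => [iT|]; last by rewrite eqxx.
  by rewrite -memD (subsetP sTD).
have -> : dH F B = #|diff A B :\: T|.
  by apply: eq_card => i; rewrite in_setD !inE ffunE; case: ifP => //; rewrite eqxx.
by rewrite cardsDS // subnKC // subset_leq_card.
Qed.

(* A crossing clause has just one variable of [D] outside [T]; adding it to [T]
   brings this clause inside [T]. *)
Lemma dH_hole n (Phi : formula n) (A B : assignment n) :
  is_hole Phi A B -> (dH A B <= #|Phi|.+1)%N.
Proof.
move=> hole; have /and3P[/'forall_implyP satA /'forall_implyP satB _] := hole.
rewrite -[dH A B]/#|diff A B|; set D := diff A B.
pose inside (T : {set 'I_n}) := [set C in Phi | vars C :&: D \subset T].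
(* [T] grows from a singleton, each new variable bringing at least one further clause inside. The
   case [m.+1 = #|D|] gives the bound. *)
suff grow m : (m < #|D|)%N -> exists T : {set 'I_n},
    [/\ T \subset D, #|T| = m.+1 & (m <= #|inside T|)%N].
  case DE: #|D| => [//|m]; have [|T [_ _ le_m]] := grow m; first by rewrite DE.
  by rewrite ltnS (leq_trans le_m) // subset_leq_card //; apply/subsetP => C; rewrite inE => /andP[].
elim: m => [|m IHm] ltmD.
  by have [i iD] := card_gt0P ltmD; exists [set i]; rewrite sub1set cards1.
have [T [sTD cT le_m]] := IHm (ltnW ltmD).
have [||C CPhi /andP[nsub meets]] := hole_crossing n Phi A B T hole.
- by rewrite -card_gt0 cT.
- by rewrite properEcard sTD cT.
have [i /setIP[iC iT]] := set0Pn _ meets.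
have [j jCD jT] := subsetPn nsub; have /setIP[jC jD] := jCD.
exists (j |: T); split.
- by rewrite subUset sub1set jD.
- by rewrite cardsU1 jT cT.
have nij : i != j by apply: contraNneq jT => <-.
(* [i] in [T] and [j] outside it already exhaust the two variables that [C] may have in [D]. *)
have CDE : [set i; j] = vars C :&: D.
  apply/eqP; rewrite eqEcard cards2 nij card_vars_diff ?satA ?satB // andbT.
  by rewrite subUset !sub1set jCD in_setI iC (subsetP sTD).
apply: leq_ltn_trans le_m (proper_card _); apply/properP; split.
  apply/subsetP => C'; rewrite !inE => /andP[-> sub] /=.
  exact: subset_trans sub (subsetUr _ _).
exists C; rewrite inE CPhi //=.
by rewrite -CDE subUset !sub1set !inE eqxx iT orbT.
Qed.

(** * Counting the possible clauses *)

Lemma card_all_clauses n k : (#|all_clauses n k| <= 2 ^ k * 'C(n, k))%N.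
Proof.
pose code (C : clause n) := (vars C, [set i in vars C | (i, true) \in C]).
pose codes := [set ST : {set 'I_n} * {set 'I_n} | (#|ST.1| == k) && (ST.2 \subset ST.1)].
have inj_code : {in all_clauses n k &, injective code}.
  have memF (C : clause n) (i : 'I_n) : C \in all_clauses n k ->
      ((i, false) \in C) = (i \in vars C) && ((i, true) \notin C).
    rewrite inE => /andP[/eqP cC /eqP cV].
    (* As many variables as literals: no variable occurs with both signs, so the variable set and
       its positive part determine the clause. *)
    have /imset_injP inj : #|vars C| == #|C| by rewrite cC -cV.
    apply/idP/andP => [iF | [/imsetP[[j b] jC /= ->]]]; last by case: b jC => ->.
    by split; [exact: mem_vars iF | apply/negP => /(inj _ _ iF)/(_ erefl)].
  move=> C1 C2 C1k C2k [eqV eqT].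
  have eqt i : ((i, true) \in C1) = ((i, true) \in C2).
    move/setP/(_ i): eqT; rewrite !inE.
    have [/mem_vars -> | _] := boolP ((i, true) \in C1);
      have [/mem_vars -> | _] := boolP ((i, true) \in C2); by rewrite ?andbF.
  by apply/setP => -[i []]; rewrite ?eqt // !memF // eqV eqt.
have sub : code @: all_clauses n k \subset codes.
  apply/subsetP => _ /imsetP[C Ck ->]; move: Ck; rewrite !inE => /andP[_ -> /=].
  by apply/subsetP => i; rewrite inE => /andP[].
rewrite -(card_in_imset inj_code); apply: leq_trans (subset_leq_card sub) _.
have -> : #|codes| =
    (\sum_(S : {set 'I_n} | #|S| == k) \sum_(T : {set 'I_n} | T \subset S) 1)%N.
  by rewrite pair_big_dep -sum1_card; apply: eq_bigl => ST; rewrite inE.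
rewrite (eq_bigr (fun=> 2 ^ k)%N) => [|S /eqP cS]; last first.
  by rewrite -cS -card_powerset -sum1_card; apply: eq_bigl => T; rewrite powersetE.
rewrite sum_nat_const mulnC leq_mul2l -[X in 'C(X, k)]card_ord -card_draws.
by rewrite cardsE leqnn orbT.
Qed.

(** Makes the denominator of [clause_prob] positive, and the probability at most 1 when [c <= 1]. *)
Lemma leq_clause_count n k : (0 < k <= n)%N -> (n <= 2 ^ k * 'C(n, k))%N.
Proof.
case: n k => [|n] [|k] // kn.
apply: (@leq_trans (k.+1 * 'C(n.+1, k.+1))); last by rewrite leq_mul2r ltnW ?orbT // ltn_expl.
by rewrite -mul_bin_diag leq_pmulr // bin_gt0.
Qed.

(** * Real sums over subsets and the Chernoff bound *)

HB.instance Definition _ := Monoid.isComLaw.Build R 0 Rplus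
  (fun x y z => esym (Rplus_assoc x y z)) Rplus_comm Rplus_0_l.
HB.instance Definition _ := Monoid.isComLaw.Build R 1 Rmult
  (fun x y z => esym (Rmult_assoc x y z)) Rmult_comm Rmult_1_l.
HB.instance Definition _ := Monoid.isMulLaw.Build R 0 Rmult Rmult_0_l Rmult_0_r.
HB.instance Definition _ := Monoid.isAddLaw.Build R Rmult Rplus
  Rmult_plus_distr_r Rmult_plus_distr_l.

Lemma foldr_rsum (I : finType) (A : {set I}) (F : I -> R) :
  foldr (fun i acc => F i + acc) 0 (enum A) = \big[Rplus/0]_(i | i \in A) F i.
Proof.
by rewrite -big_enum; elim: (enum A) => [|i s IHs]; rewrite ?big_nil ?big_cons //= IHs.
Qed.

Lemma rsum_le (I : finType) (P : pred I) (F G : I -> R) :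
  (forall i, P i -> F i <= G i) -> \big[Rplus/0]_(i | P i) F i <= \big[Rplus/0]_(i | P i) G i.
Proof. by move=> le_FG; apply: (big_ind2 Rle) => // *; lra. Qed.

Lemma rprod_const (I : finType) (X : {set I}) (x : R) :
  \big[Rmult/1]_(i in X) x = x ^ #|X|.
Proof. by rewrite big_const; elim: #|X| => //= m ->. Qed.

(** The binomial theorem over subsets. With [y = 1 - p], taking [x = p] gives total probability 1,
    and [x = p * exp u] the exponential moment of the size. *)
Lemma rsum_subsets (I : finType) (X : {set I}) (x y : R) :
  \big[Rplus/0]_(S : {set I} | S \subset X) (x ^ #|S| * y ^ (#|X| - #|S|)) = (x + y) ^ #|X|.
Proof.
(* Factors [0 + 1] outside [X] extend the product to all of [I] and cancel the terms of sets not
   contained in [X]. *)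
have -> : (x + y) ^ #|X| = \big[Rmult/1]_(i : I)
    ((if i \in X then x else 0) + (if i \in X then y else 1)).
  rewrite -rprod_const big_mkcond; apply: eq_bigr => i _.
  by case: (i \in X); rewrite ?Rplus_0_l.
rewrite bigA_distr /= big_mkcond; apply: eq_bigr => S _.
case: ifPn => [sSX | /subsetPn[i iS iX]]; last first.
  by rewrite (bigD1 i) //= iS (negPf iX) Rmult_0_l.
rewrite -cardsDS // -!rprod_const big_mkcond [X in _ * X]big_mkcond -big_split.
apply: eq_bigr => i _ /=; rewrite in_setD.
case: ifP => [iS|_]; first by rewrite (subsetP sSX) //= Rmult_1_r.
by rewrite Rmult_1_l.
Qed.

Lemma exp_le (x y : R) : x <= y -> exp x <= exp y.
Proof. by case=> [/exp_increasing/Rlt_le // | ->]; apply: Rle_refl. Qed.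

Lemma pow_exp (u : R) (m : nat) : exp u ^ m = exp (u * INR m).
Proof.
elim: m => [|m IHm]; first by rewrite Rmult_0_r exp_0.
by rewrite S_INR Rmult_plus_distr_l Rmult_1_r exp_plus /= IHm Rmult_comm.
Qed.

(* Chernoff's bound with tilting parameter [u], applied to the number of clauses. *)
Lemma Prob_ge n k (c a u : R) (E : pred (formula n)) :
  0 <= c -> 0 <= clause_prob n k c <= 1 -> 0 <= u -> (0 < k <= n)%N ->
  (forall Phi, is_instance k Phi -> ~~ E Phi -> a <= INR #|Phi|) ->
  1 - exp (c * INR n * (exp u - 1) - u * a) <= Prob n k c E.
Proof.
move=> c0 p01 u0 kn failE; rewrite /Prob foldr_rsum.
set p := clause_prob n k c in p01 *; set X := all_clauses n k.
set w := fun Phi : formula n => p ^ #|Phi| * (1 - p) ^ (#|X| - #|Phi|).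
have w0 Phi : 0 <= w Phi by apply: Rmult_le_pos; apply: pow_le; lra.
have -> : \big[Rplus/0]_(Phi | Phi \in [set Phi | is_instance k Phi])
    (if E Phi then w Phi else 0) =
  \big[Rplus/0]_(Phi : formula n | Phi \subset X) (if E Phi then w Phi else 0).
  by apply: eq_bigl => Phi; rewrite inE.
(* The weight of each [Phi] is covered by the first sum if [E Phi] holds; otherwise by the second
   term, where it is multiplied by [exp (u * (INR #|Phi| - a)) >= 1]. *)
have le1 : 1 <= \big[Rplus/0]_(Phi : formula n | Phi \subset X) (if E Phi then w Phi else 0) +
    exp (- (u * a)) * (p * exp u + (1 - p)) ^ #|X|.
  rewrite -[X in X <= _](pow1 #|X|) -[X in X ^ _ <= _](Rplus_minus p 1).
  rewrite -!rsum_subsets big_distrr -big_split; apply: rsum_le => Phi PhiX /=.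
  rewrite Rpow_mult_distr -/(w Phi) pow_exp.
  have -> : exp (- (u * a)) *
      (p ^ #|Phi| * exp (u * INR #|Phi|) * (1 - p) ^ (#|X| - #|Phi|)) =
    w Phi * exp (u * (INR #|Phi| - a)).
    rewrite /w Rmult_minus_distr_l /Rminus exp_plus; ring.
  case: ifPn => [_|/(failE _ PhiX) aPhi].
    have := Rmult_le_pos _ _ (w0 Phi) (Rlt_le _ _ (exp_pos (u * (INR #|Phi| - a)))).
    lra.
  rewrite Rplus_0_l -[X in X <= _]Rmult_1_r; apply: Rmult_le_compat_l => //.
  rewrite -exp_0; apply: exp_le; apply: Rmult_le_pos; lra.
suff : exp (- (u * a)) * (p * exp u + (1 - p)) ^ #|X| <=
    exp (c * INR n * (exp u - 1) - u * a) by lra.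
have -> : c * INR n * (exp u - 1) - u * a = - (u * a) + c * INR n * (exp u - 1) by ring.
rewrite exp_plus.
apply: Rmult_le_compat_l; first exact/Rlt_le/exp_pos.
have eu1 : 1 <= exp u by rewrite -exp_0; apply: exp_le.
have base_ge0 : 0 <= p * exp u + (1 - p).
  have := Rmult_le_compat_l p 1 (exp u) (proj1 p01) eu1; lra.
have base_le : p * exp u + (1 - p) <= exp (p * (exp u - 1)).
  have := exp_ineq1_le (p * (exp u - 1)); lra.
apply: Rle_trans (pow_incr _ _ #|X| (conj base_ge0 base_le)) _.
rewrite pow_exp; apply: exp_le.
have -> : p * (exp u - 1) * INR #|X| = INR #|X| * p * (exp u - 1) by ring.
apply: Rmult_le_compat_r; first lra.
have count_gt0 : 0 < INR (2 ^ k * 'C(n, k)).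
  apply: lt_0_INR; apply/ltP; apply: leq_trans (leq_clause_count _ _ kn).
  by case/andP: kn; apply: leq_trans.
have -> : c * INR n = INR (2 ^ k * 'C(n, k)) * p.
  by rewrite /p /clause_prob; field; apply: Rgt_not_eq.
by apply: Rmult_le_compat_r; [lra | apply: le_INR; apply/leP; exact: card_all_clauses].
Qed.

Lemma clause_prob_le1 n k (c : R) :
  0 <= c <= 1 -> (0 < k <= n)%N -> 0 <= clause_prob n k c <= 1.
Proof.
move=> c01 kn; have /leP/le_INR le_n := leq_clause_count _ _ kn.
have n0 : 0 < INR n.
  by apply: lt_0_INR; apply/ltP; case/andP: kn; apply: leq_trans.
rewrite /clause_prob; split.
  apply: Rmult_le_pos; first by apply: Rmult_le_pos; lra.
  by apply/Rlt_le/Rinv_0_lt_compat; lra.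
apply: (Rmult_le_reg_r (INR (2 ^ k * 'C(n, k)))); first lra.
rewrite /Rdiv Rmult_assoc Rinv_l; last lra.
have := Rmult_le_compat_r (INR n) c 1 (Rlt_le _ _ n0) (proj2 c01); lra.
Qed.

(** * Choice of the tilting parameter and exponential decay *)

Lemma exp_rate (c e : R) : 0 < c < e -> exists2 u, 0 < u & c * (exp u - 1) < e * u.
Proof.
move=> [c0 ce].
(* This makes [e * (1 - u)] the midpoint of [c] and [e], hence above [c]; the bound
   [exp u * (1 - u) <= 1] then does the rest. *)
pose u := (1 - c / e) / 2.
have ce0 : 0 < c / e by apply: Rdiv_lt_0_compat; lra.
have ce1 : c / e < 1 by apply: (Rmult_lt_reg_r e); [lra | rewrite /Rdiv Rmult_assoc Rinv_l; lra].
have u0 : 0 < u by rewrite /u; lra.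
exists u => //.
have lt_e : c < e * (1 - u).
  have -> : e * (1 - u) = (e + c) / 2 by rewrite /u; field; lra.
  lra.
have eu0 := exp_pos u.
have le_u : exp u * (1 - u) <= 1.
  have := exp_ineq1_le (- u); rewrite exp_Ropp => h.
  have := Rmult_le_compat_l (exp u) _ _ (Rlt_le _ _ eu0) h.
  rewrite Rinv_r; lra.
have eu1 : 0 < exp u - 1 by have := exp_ineq1 u; lra.
apply: Rlt_le_trans (_ : e * (1 - u) * (exp u - 1) <= _).
  exact: Rmult_lt_compat_r.
have -> : e * (1 - u) * (exp u - 1) = e * (exp u * (1 - u) - 1 + u) by ring.
by apply: Rmult_le_compat_l; lra.
Qed.

Lemma exp_decay (u r delta : R) : 0 < r -> 0 < delta ->
  exists N : nat, forall n : nat, (N <= n)%N -> exp (u - r * INR n) <= delta.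
Proof.
move=> r0 d0; have [N N_gt] := INR_archimed r (u - ln delta) r0.
exists N => n /leP/le_INR Nn.
rewrite -[X in _ <= X]exp_ln //; apply: exp_le.
have : INR N * r <= INR n * r by apply: Rmult_le_compat_r; lra.
lra.
Qed.

(** * Absence of linear-size holes *)

Theorem theorem4 :
  forall k : nat, (3 <= k)%N ->
  exists eps : R, 0 < eps < 1 / INR (k - 1) /\
    forall c : R, 0 < c < 1 / INR 'C(k, 2) ->
      forall delta : R, 0 < delta ->
        exists N : nat, forall n : nat, (N <= n)%N ->
          1 - delta <= Prob n k c (fun Phi => ~~ has_big_hole n eps Phi).
Proof.
move=> k k3.
have k1_gt0 : 0 < INR (k - 1).
  by apply: lt_0_INR; apply/ltP; rewrite subn_gt0 (leq_trans _ k3).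
(* By Pascal's rule the difference is ['C(k - 1, 2)], positive because [k >= 3]. *)
have lt_bin : INR (k - 1) < INR 'C(k, 2).
  apply: lt_INR; apply/ltP; case: k k3 {k1_gt0} => [|[|[|k]]] // _.
  by rewrite binS bin1 subn1 /= -[X in (X < _)%N]add0n ltn_add2r bin_gt0.
have bin_ge1 : 1 <= INR 'C(k, 2).
  by rewrite -[1]/(INR 1); apply: le_INR; apply/leP; rewrite bin_gt0 (leq_trans _ k3).
exists (1 / INR 'C(k, 2)); split.
  split; first by apply: Rdiv_lt_0_compat; lra.
  apply: Rmult_lt_compat_l; first lra.
  by apply: Rinv_lt_contravar => //; apply: Rmult_lt_0_compat; lra.
set e := 1 / INR 'C(k, 2) => c ce delta delta0.
have e_le1 : e <= 1.
  by rewrite /e -{2}(Rdiv_1_r 1); apply: Rmult_le_compat_l; [lra | apply: Rinv_le_contravar; lra].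
have [u u0 rate] := exp_rate _ _ ce.
have [||N decay] := exp_decay u (e * u - c * (exp u - 1)) delta; [lra | by [] |].
exists (maxn k N) => n; rewrite geq_max => /andP[kn Nn].
have kn' : (0 < k <= n)%N by rewrite kn (leq_trans _ k3).
(* A hole of size at least [e * INR n] forces at least [e * INR n - 1] clauses. The [- 1] costs only
   a constant factor [exp u], which the decay in [n] absorbs. *)
apply: Rle_trans (Prob_ge n k c (e * INR n - 1) u _ _ _ _ kn' _); try lra.
- have := decay n Nn.
  have -> : c * INR n * (exp u - 1) - u * (e * INR n - 1) =
            u - (e * u - c * (exp u - 1)) * INR n by ring.
  lra.
- by apply: clause_prob_le1 => //; lra.
move=> Phi _; rewrite negbK => /existsP[A /existsP[B /andP[/dH_hole/leP/le_INR]]].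
rewrite S_INR /Rleb; case: Rle_dec => // le_d le_dH _; lra.
Qed.
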